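(* Let $S \in \{\mathbb{FT}, \overline{\mathbb{T}}\}$ and let $A, B \in M_n(S)$. If $A \leq_{\mathcal{J}} B$ in the semigroup $M_n(S)$, then (i) $PC_S(A)$ embeds isometrically into $PC_S(B)$; and (ii) $PR_S(A)$ embeds isometrically into $PR_S(B)$, where isometric embedding is with respect to the Hilbert projective metric $d_H$.
   Context: Semirings: $\mathbb{FT}$ (finitary tropical semiring) is the set $\mathbb{R}$ with $a \oplus b = \max(a,b)$ and $a \otimes b = ab = a+b$ (ordinary sum). $\mathbb{T} = \mathbb{FT} \cup \{-\infty\}$, where $-\infty$ is absorbing for $\otimes$ and is the identity for $\oplus$. $\overline{\mathbb{T}} = \mathbb{T} \cup \{+\infty\}$, where $+\infty$ is absorbing for both $\oplus$ and $\otimes$, except that $(-\infty)\otimes(+\infty) = (+\infty)\otimes(-\infty) = -\infty$. Order: $-\infty < x < +\infty$ for $x \in \mathbb{R}$, extended componentwise to vectors; negation is extended by $-(\pm\infty) = \mp\infty$. $M_n(S)$ is the semigroup of $n \times n$ matrices over $S$ under matrix multiplication induced from $\oplus$ and $\otimes$. $S^n$ has componentwise $\oplus$ and scaling $(\lambda \otimes x)_i = \lambda \otimes x_i$. The row space $R_S(A)$ (respectively column space $C_S(A)$) is the set of all $S$-linear combinations of the rows (respectively columns) of $A$, regarded as a subset of $S^n$. Projective space is the quotient of $S^n$ identifying two vectors if one is a scalar multiple $\lambda \otimes (\cdot)$ of the other with $\lambda \in \mathbb{FT}$; $PR_S(A)$ and $PC_S(A)$ are the images of $R_S(A)$ and $C_S(A)$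 in this quotient. For $x, y \in \overline{\mathbb{T}}^n$ let $\langle x \mid y \rangle = \max\{\lambda \in \overline{\mathbb{T}} : \lambda \otimes x \leq y\} \in \overline{\mathbb{T}}$. The Hilbert projective metric is $d_H(x,y) = 0$ if $x$ is a finite (i.e. by an element of $\mathbb{FT}$) scalar multiple of $y$, and $d_H(x,y) = -(\langle x \mid y\rangle \otimes \langle y \mid x \rangle)$ otherwise. It is invariant under scaling by finite scalars, so is well defined on projective space, where it is a (possibly extended, i.e. allowing value $+\infty$) metric. ''$X$ embeds isometrically into $Y$'' means there is a map $X \to Y$ preserving $d_H$. For a semigroup $M$, let $M^1 = M$ if $M$ is a monoid and otherwise $M^1$ is $M$ with an identity adjoined. Then $a \leq_{\mathcal{J}} b$ means $M^1 a M^1 \subseteq M^1 b M^1$. *)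

(* Defs.v *)
From HB Require Import structures.
From mathcomp Require Import all_boot all_order all_algebra generic_quotient.
From mathcomp Require Import all_classical all_reals.
From mathcomp Require Import ereal.

Set Implicit Arguments.
Unset Strict Implicit.
Unset Printing Implicit Defensive.

Import Order.TTheory GRing.Theory Num.Theory.
Local Open Scope classical_set_scope.
Local Open Scope quotient_scope.
Local Open Scope ring_scope.

Section GreenJ.
Variables (M : Type) (op : M -> M -> M).

Definition is_monoid : Prop := exists e : M, forall x, op e x = x /\ op x e = x.

(* [None] plays the role of the adjoined identity: M^1 is [Some @` setT] when M
   is a monoid, and all of [option M] otherwise. *)
Definition mul1 (x y : option M) : option M :=
  match x, y with
  | None, _ => y
  | _, None => x
  | Some a, Some b => Some (op a b)
  end.

Definition M1 : set (option M) := [set x | x = None -> ~ is_monoid].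

Definition ideal1 (a : M) : set (option M) :=
  [set mul1 (mul1 x (Some a)) y | x in M1 & y in M1].

Definition leJ (a b : M) : Prop := ideal1 a `<=` ideal1 b.

End GreenJ.

Inductive tropical := FT | Tbar.

Section Tropical.
Variable R : realType.

Definition carrier (S : tropical) : choiceType :=
  match S with FT => R : choiceType | Tbar => \bar R : choiceType end.

Definition toplus (S : tropical) : carrier S -> carrier S -> carrier S :=
  match S with
  | FT => fun a b : R => Num.max a b
  | Tbar => fun a b : \bar R => Order.max a b
  end.

(* [adde] satisfies (-oo) + (+oo) = (+oo) + (-oo) = -oo, as required. *)
Definition totimes (S : tropical) : carrier S -> carrier S -> carrier S :=
  match S with
  | FT => fun a b : R => a + b
  | Tbar => fun a b : \bar R => (a + b)%E
  end.

Definition of_fin (S : tropical) : R -> carrier S :=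
  match S with FT => fun r => r | Tbar => fun r => r%:E end.

Definition to_ext (S : tropical) : carrier S -> \bar R :=
  match S with FT => fun r : R => r%:E | Tbar => fun x => x end.

(* f 0 (+) ... (+) f n. FT has no additive identity, so only nonempty sums make
   sense; this is why matrices are taken of size n.+1. *)
Definition tsum (S : tropical) (n : nat) (f : 'I_n.+1 -> carrier S) : carrier S :=
  \big[@toplus S / f ord0]_(i < n) f (lift ord0 i).

Definition tmulmx (S : tropical) (n : nat) (A B : 'M[carrier S]_n.+1) :
    'M[carrier S]_n.+1 :=
  \matrix_(i, j) tsum (fun k => totimes (A i k) (B k j)).

Definition tscale (S : tropical) (n : nat) (l : carrier S)
    (x : 'rV[carrier S]_n) : 'rV[carrier S]_n :=
  \row_i totimes l (x 0 i).

Definition lincomb (S : tropical) (m n : nat) (c : 'I_m.+1 -> carrier S)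
    (v : 'I_m.+1 -> 'rV[carrier S]_n) : 'rV[carrier S]_n :=
  \row_j tsum (fun i => tscale (c i) (v i) 0 j).

Definition rowspace (S : tropical) (n : nat) (A : 'M[carrier S]_n.+1) :
    set 'rV[carrier S]_n.+1 :=
  [set x | exists c, x = lincomb c (fun i => row i A)].

Definition colspace (S : tropical) (n : nat) (A : 'M[carrier S]_n.+1) :
    set 'rV[carrier S]_n.+1 :=
  [set x | exists c, x = lincomb c (fun j => (col j A)^T)].

Definition fin_multiple (S : tropical) (n : nat) (x y : 'rV[carrier S]_n) : Prop :=
  exists l : R, x = tscale (of_fin S l) y.

(* The maximum is attained, see [bracket_max]. *)
Definition bracket (n : nat) (x y : 'rV[\bar R]_n) : \bar R :=
  ereal_sup [set l | forall i, (l + x 0%R i <= y 0%R i)%E].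

(* The first case is needed: e.g. x = y = const_mx +oo would get -oo from the
   second formula. *)
Definition dH_ext (n : nat) (x y : 'rV[carrier Tbar]_n) : \bar R :=
  if `[< fin_multiple x y >] then 0%E
  else (- (bracket x y + bracket y x))%E.

Definition dH (S : tropical) (n : nat) (x y : 'rV[carrier S]_n) : \bar R :=
  dH_ext (map_mx (@to_ext S) x : 'rV[carrier Tbar]_n)
         (map_mx (@to_ext S) y : 'rV[carrier Tbar]_n).

Definition proj_rel (S : tropical) (n : nat) : rel 'rV[carrier S]_n :=
  fun x y => `[< fin_multiple x y >].

Lemma tscale0 S n (x : 'rV[carrier S]_n) : tscale (of_fin S 0) x = x.
Proof.
apply/rowP => i; rewrite mxE; case: S x => x /=; [exact: add0r|exact: add0e].
Qed.

Lemma tscaleD S n (x : 'rV[carrier S]_n) (k l : R) :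
  tscale (of_fin S k) (tscale (of_fin S l) x) = tscale (of_fin S (k + l)) x.
Proof.
by apply/rowP => i; rewrite !mxE; case: S x => x /=; rewrite ?EFinD ?addrA ?addeA.
Qed.

Lemma proj_rel_refl S n : reflexive (@proj_rel S n).
Proof. by move=> x; apply/asboolP; exists 0; rewrite tscale0. Qed.

Lemma fin_multiple_sym S n (x y : 'rV[carrier S]_n) :
  fin_multiple x y -> fin_multiple y x.
Proof. by move=> [l ->]; exists (- l); rewrite tscaleD addNr tscale0. Qed.

Lemma proj_rel_sym S n : symmetric (@proj_rel S n).
Proof. by move=> x y; apply/asboolP/asboolP; exact: fin_multiple_sym. Qed.

Lemma fin_multiple_trans S n (x y z : 'rV[carrier S]_n) :
  fin_multiple x y -> fin_multiple y z -> fin_multiple x z.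
Proof. by move=> [k ->] [l ->]; exists (k + l); rewrite tscaleD. Qed.

Lemma proj_rel_trans S n : transitive (@proj_rel S n).
Proof.
move=> y x z /asboolP xy /asboolP yz; apply/asboolP.
exact: fin_multiple_trans xy yz.
Qed.

Canonical proj_equiv (S : tropical) (n : nat) : equiv_rel 'rV[carrier S]_n :=
  EquivRel (@proj_rel S n) (@proj_rel_refl S n) (@proj_rel_sym S n)
    (@proj_rel_trans S n).

Definition proj (S : tropical) (n : nat) := {eq_quot (@proj_equiv S n)}.

Definition to_proj (S : tropical) (n : nat) (x : 'rV[carrier S]_n) : proj S n :=
  \pi_({eq_quot (@proj_equiv S n)}) x.

Definition PR (S : tropical) (n : nat) (A : 'M[carrier S]_n.+1) : set (proj S n.+1) :=
  @to_proj S n.+1 @` rowspace A.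

Definition PC (S : tropical) (n : nat) (A : 'M[carrier S]_n.+1) : set (proj S n.+1) :=
  @to_proj S n.+1 @` colspace A.

(* Independent of the choice of representatives, see [dHP_to_proj]. *)
Definition dHP (S : tropical) (n : nat) (p q : proj S n) : \bar R :=
  dH (repr p) (repr q).

Definition embeds_isometrically (S : tropical) (n : nat) (X Y : set (proj S n)) : Prop :=
  exists f : proj S n -> proj S n,
    (forall p, X p -> Y (f p)) /\
    (forall p q, X p -> X q -> dHP (f p) (f q) = dHP p q).

Lemma bracket_max n (x y : 'rV[\bar R]_n) :
  (forall i, (bracket x y + x 0%R i <= y 0%R i)%E) /\
  (forall l : \bar R, (forall i, (l + x 0%R i <= y 0%R i)%E) ->
     (l <= bracket x y)%E).
Proof.
split; last by move=> l hl; exact: ereal_sup_ubound.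
move=> i.
have res (a b : \bar R) : exists c : \bar R,
    forall l : \bar R, (l + a <= b)%E <-> (l <= c)%E.
  case: a => [a||].
  - exists (b - a%:E)%E => l.
    by rewrite -leeBrDr // -EFinN; split.
  - case: (eqVneq b +oo%E) => [->|bny].
      by exists +oo%E => l; rewrite !leey; split.
    exists -oo%E => l; split; last first.
      by rewrite leeNy_eq => /eqP ->; rewrite addNye leNye.
    by case: l => [l||] //=; case: b bny.
  - by exists +oo%E => l; rewrite addeNy leNye leey; split.
have [c cP] := res (x 0%R i) (y 0%R i).
by apply/cP; apply: ge_ereal_sup => l /(_ i) /cP.
Qed.

Lemma bracket_shift n (x y : 'rV[carrier Tbar]_n) (k l : R) :
  bracket (tscale (of_fin Tbar k) x) (tscale (of_fin Tbar l) y)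
  = (bracket x y + (l - k)%:E)%E.
Proof.
have [h1 m1] := bracket_max (tscale (of_fin Tbar k) x) (tscale (of_fin Tbar l) y).
have [h2 m2] := bracket_max x y.
apply/eqP; rewrite eq_le; apply/andP; split.
- rewrite -leeBlDr // -EFinN opprB; apply: m2 => i.
  move: (h1 i); rewrite !mxE /=; move: (bracket _ _) => b.
  rewrite [(l%:E + _)%E]addeC -leeBlDr // -EFinN => /(le_trans _); apply.
  by rewrite EFinD !addeA [leRHS]addeAC.
- apply: m1 => i; rewrite !mxE /=.
  rewrite [(l%:E + _)%E]addeC; apply: le_trans (leeD2r l%:E (h2 i)).
  rewrite -!addeA leeD2l // addeA -EFinD subrK addeC.
  by [].
Qed.

Lemma dH_tscale S n (x y : 'rV[carrier S]_n) (k l : R) :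
  dH (tscale (of_fin S k) x) (tscale (of_fin S l) y) = dH x y.
Proof.
have mapZ (z : 'rV[carrier S]_n) (m : R) :
    map_mx (@to_ext S) (tscale (of_fin S m) z) =
    tscale (of_fin Tbar m) (map_mx (@to_ext S) z : 'rV[carrier Tbar]_n).
  by apply/rowP => i; rewrite !mxE; case: S z {x y} => z /=; rewrite ?EFinD.
rewrite /dH !mapZ; move: (map_mx _ x) (map_mx _ y) => {}x {}y.
rewrite /dH_ext !bracket_shift; congr (if _ then _ else _).
  have fm (z : 'rV[carrier Tbar]_n) (m : R) :
      fin_multiple (tscale (of_fin Tbar m) z) z by exists m.
  apply/asboolP/asboolP => h.
    apply: (fin_multiple_trans (fin_multiple_sym (fm x k))).
    exact: (fin_multiple_trans h (fm y l)).
  apply: (fin_multiple_trans (fm x k)).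
  exact: (fin_multiple_trans h (fin_multiple_sym (fm y l))).
by rewrite addeACA -EFinD addrA subrK subrr adde0.
Qed.

Lemma dHP_to_proj S n (x y : 'rV[carrier S]_n) :
  dHP (to_proj x) (to_proj y) = dH x y.
Proof.
have reprP (z : 'rV[carrier S]_n) : fin_multiple (repr (to_proj z)) z.
  apply/asboolP; rewrite -[asbool _]/(proj_equiv S n _ _).
  by apply/eqmodP; rewrite /to_proj reprK.
have [[k hx] [l hy]] := (reprP x, reprP y).
by rewrite /dHP hx hy dH_tscale.
Qed.

End Tropical.

(* Main.v *)
Require Import Defs.
From mathcomp Require Import all_boot all_order all_algebra.
From mathcomp Require Import all_classical all_reals.
From mathcomp Require Import ereal generic_quotient.

(** Write [A = P B Q], where either factor may be missing.  Since [C(BQ)] is contained in [C(B)], right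
    multiplication is harmless, and the real content is that [PC(PB)] embeds
    isometrically into [PC(B)], although [C(PB)] is an image of [C(B)] and not
    a subset of it.

    Every matrix acts as a residuated map: for each [y] there is a greatest
    vector [r y] such that [PB (r y) <= y] ([tapp_residual]).  The embedding is
    [g y := B (r y)].  On [C(PB)] one has [P (g y) = PB (r y) = y], so [P] is a
    left inverse of [g].  As [P] and [B] are monotone and commute with scalars,
    [l x <= y] is equivalent to [l (g x) <= g y] for every scalar [l]
    ([tscale_le_section]).  The distance between [x] and [y] depends only on the
    scalars [l] such that [l x <= y] and those such that [l y <= x]
    ([eq_dH_scalars]), so [g] is an isometry.

    Transposition reverses products and exchanges row and column spaces, which
    reduces the statement on row spaces to the one on column spaces. *)

Set Implicit Arguments.
Unset Strict Implicit.
Unset Printing Implicit Defensive.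

Import Order.TTheory GRing.Theory Num.Theory.

Section Embedding.
Local Open Scope classical_set_scope.
Local Open Scope ring_scope.
Variables (R : realType) (S : tropical).
Local Notation K := (carrier R S).

(** * Order and residuation on scalars *)

(** Going through [to_ext] lets both semirings share the order of [\bar R]. *)
Definition tle (a b : K) : Prop := (to_ext a <= to_ext b)%E.

Lemma to_ext_inj : injective (@to_ext R S).
Proof. by case: S => // a b []. Qed.

Lemma to_ext_toplus (a b : K) :
  to_ext (toplus a b) = Order.max (to_ext a) (to_ext b).
Proof. by rewrite /toplus /to_ext; case: S a b => // a b; rewrite EFin_max. Qed.

Lemma to_ext_totimes (a b : K) :
  to_ext (totimes a b) = (to_ext a + to_ext b)%E.
Proof. by case: S a b. Qed.

Lemma totimesC (a b : K) : totimes a b = totimes b a.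
Proof. by apply: to_ext_inj; rewrite !to_ext_totimes addeC. Qed.

Lemma totimesA (a b c : K) : totimes a (totimes b c) = totimes (totimes a b) c.
Proof. by apply: to_ext_inj; rewrite !to_ext_totimes addeA. Qed.

Lemma tle_refl (a : K) : tle a a.
Proof. exact: lexx. Qed.

Lemma tle_trans (b a c : K) : tle a b -> tle b c -> tle a c.
Proof. exact: le_trans. Qed.

Lemma tle_anti (a b : K) : tle a b -> tle b a -> a = b.
Proof. by move=> ab ba; apply/to_ext_inj/le_anti/andP. Qed.

Lemma eq_by_upper_bounds (a b : K) : (forall z, tle a z <-> tle b z) -> a = b.
Proof. by move=> h; apply: tle_anti; [apply/h|apply/h]; exact: tle_refl. Qed.

(** For [a] finite this is subtraction.  For infinite [a] the greatest
    solution is [+oo] or [-oo]; solutions exist even for [a = +oo] because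
    [(-oo) + (+oo) = -oo]. *)
Lemma totimes_residual (a b : K) :
  exists c, forall l, tle (totimes l a) b <-> tle l c.
Proof.
rewrite /tle; case: S a b => /= a b.
  by exists (b - a) => l; rewrite !lee_fin lerBrDr.
case: a => [a||].
- by exists (b - a%:E)%E => l; rewrite leeBrDr.
- have [->|bny] := eqVneq b +oo%E; first by exists +oo%E => l; rewrite !leey.
  exists -oo%E => l; split; last first.
    by rewrite leeNy_eq => /eqP ->; rewrite addNye leNye.
  by case: l => [l||] //=; case: b bny.
- by exists +oo%E => l; rewrite addeNy leNye leey.
Qed.

Lemma finite_inf (n : nat) (c : 'I_n.+1 -> K) :
  exists k, forall l, (forall i, tle l (c i)) <-> tle l (c k).
Proof.
exists [arg min_(i < ord0) to_ext (c i)]%O => l.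
case: arg_minP => // k _ kP; split=> [|lk i]; first exact.
by apply: le_trans lk (kP i _).
Qed.

Lemma toplus_leP (a b z : K) : tle (toplus a b) z <-> tle a z /\ tle b z.
Proof. by rewrite /tle to_ext_toplus ge_max; split=> /andP. Qed.

Lemma big_toplus_leP (I : eqType) (s : seq I) (a : K) (f : I -> K) (z : K) :
  tle (\big[@toplus R S/a]_(i <- s) f i) z <->
  tle a z /\ forall i, i \in s -> tle (f i) z.
Proof.
elim: s => [|i s IH]; first by rewrite big_nil; split=> [|[]].
rewrite big_cons toplus_leP IH; split=> [[fi [az fs]]|[az fs]].
  by split=> // j; rewrite in_cons => /predU1P[->|/fs].
split; first by apply: fs; rewrite mem_head.
by split=> // j js; apply: fs; rewrite in_cons js orbT.
Qed.

Lemma tsum_leP (n : nat) (f : 'I_n.+1 -> K) (z : K) :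
  tle (tsum f) z <-> forall i, tle (f i) z.
Proof.
rewrite /tsum big_toplus_leP; split=> [[f0 fS] i|fz]; last by split.
by case: (unliftP ord0 i) => [j ->|-> //]; apply: fS; rewrite mem_index_enum.
Qed.

(** Distributivity, in the form of upper bounds. *)
Lemma tsum_mull_leP (n : nat) (f : 'I_n.+1 -> K) (a z : K) :
  tle (totimes (tsum f) a) z <-> forall i, tle (totimes (f i) a) z.
Proof.
have [c cP] := totimes_residual a z.
by rewrite cP tsum_leP; split=> h i; apply/cP.
Qed.

(** * Matrices as residuated maps *)

Section Vectors.
Variable n : nat.
Implicit Types (x y v : 'rV[K]_n.+1) (A B M P : 'M[K]_n.+1) (l : K).

Definition vle x y : Prop := forall i, tle (x 0 i) (y 0 i).

Lemma vle_refl x : vle x x.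
Proof. by move=> i; exact: tle_refl. Qed.

Lemma vle_trans y x v : vle x y -> vle y v -> vle x v.
Proof. by move=> xy yv i; apply: tle_trans (xy i) (yv i). Qed.

Lemma vle_anti x y : vle x y -> vle y x -> x = y.
Proof. by move=> xy yx; apply/rowP => i; exact: tle_anti. Qed.

Definition tapp A v : 'rV[K]_n.+1 := lincomb (v 0) (fun j => (col j A)^T).

Lemma colspaceP A x : colspace A x <-> exists v, x = tapp A v.
Proof.
split=> [[c ->]|[v ->]]; last by exists (v 0).
exists (\row_j c j); rewrite /tapp; congr lincomb.
by apply/funext => j; rewrite mxE.
Qed.

Lemma tappE A v i : tapp A v 0 i = tsum (fun k => totimes (v 0 k) (A i k)).
Proof. by rewrite mxE; congr tsum; apply/funext => k; rewrite !mxE. Qed.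

(** Both sides have the same upper bounds, namely those of all the products
    [v j * B k j * P i k]. *)
Lemma tapp_mul P B v : tapp (tmulmx P B) v = tapp P (tapp B v).
Proof.
apply/rowP => i; apply: eq_by_upper_bounds => z; rewrite !tappE !tsum_leP.
have eqL j : tle (totimes (v 0 j) (tmulmx P B i j)) z <->
    forall k, tle (totimes (totimes (v 0 j) (B k j)) (P i k)) z.
  have AC k : totimes (totimes (P i k) (B k j)) (v 0 j) =
      totimes (totimes (v 0 j) (B k j)) (P i k).
    by rewrite [LHS]totimesC [totimes (P i k) _]totimesC totimesA.
  by rewrite mxE totimesC tsum_mull_leP; split=> h k; move: (h k); rewrite AC.
have eqR k : tle (totimes (tapp B v 0 k) (P i k)) z <->
    forall j, tle (totimes (totimes (v 0 j) (B k j)) (P i k)) z.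
  by rewrite tappE tsum_mull_leP.
split=> h; first by move=> k; apply/eqR => j; move/eqL: (h j).
by move=> j; apply/eqL => k; move/eqR: (h k).
Qed.

Lemma tapp_scale A l v : tapp A (tscale l v) = tscale l (tapp A v).
Proof.
apply/rowP => i; apply: eq_by_upper_bounds => z.
rewrite [tscale _ _ 0 i]mxE !tappE totimesC tsum_mull_leP tsum_leP.
have AC k : totimes (tscale l v 0 k) (A i k) =
    totimes (totimes (v 0 k) (A i k)) l.
  by rewrite mxE -totimesA [RHS]totimesC.
by split=> h k; move: (h k); rewrite AC.
Qed.

(** The residual coordinate at [j] is the least over [i] of the residuals of
    [A i j] into [y i]. *)
Lemma tapp_residual A :
  exists r, forall y v, vle (tapp A v) y <-> vle v (r y).
Proof.
suff /choice[r rP] : forall y, exists w, forall v, vle (tapp A v) y <-> vle v w.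
  by exists r.
move=> y.
have /choice[w wP] (j : 'I_n.+1) : exists c, forall l,
    (forall i, tle (totimes l (A i j)) (y 0 i)) <-> tle l c.
  have /choice[c cP] i := totimes_residual (A i j) (y 0 i).
  have [k kP] := finite_inf c; exists (c k) => l; rewrite -kP.
  by split=> h i; apply/cP.
exists (\row_j w j) => v; split=> h.
  move=> j; rewrite mxE; apply/wP => i.
  by move: (h i); rewrite tappE tsum_leP.
by move=> i; rewrite tappE tsum_leP => j; move: (h j); rewrite mxE => /wP.
Qed.

Lemma tapp_monotone A v w : vle v w -> vle (tapp A v) (tapp A w).
Proof.
have [r rP] := tapp_residual A => vw.
by apply/rP; apply: (vle_trans vw); apply/rP; exact: vle_refl.
Qed.

(** * Scalars determine the distance *)

(** An infinite scalar over the finitary semiring carries no information: the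
    vectors involved are finite and nonempty. *)
Lemma ext_scalars x y x' y' :
    (forall l, vle (tscale l x) y <-> vle (tscale l x') y') ->
  forall l : \bar R,
    (forall i, l + to_ext (x 0%R i) <= to_ext (y 0%R i))%E <->
    (forall i, l + to_ext (x' 0%R i) <= to_ext (y' 0%R i))%E.
Proof.
move=> h l.
have fin (k : K) : to_ext k = l ->
    (forall i, l + to_ext (x 0%R i) <= to_ext (y 0%R i))%E <->
    (forall i, l + to_ext (x' 0%R i) <= to_ext (y' 0%R i))%E.
  have scaleE u v : vle (tscale k u) v <->
      forall i, (to_ext k + to_ext (u 0%R i) <= to_ext (v 0%R i))%E.
    by split=> kuv i; move: (kuv i); rewrite /tle mxE to_ext_totimes.
  by move=> <-; rewrite -!scaleE.
move: x y x' y' {h} fin; case: S => x y x' y' fin; last exact: (fin l).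
case: l fin => [r fin||] /=; first exact: (fin r).
  by split=> /(_ ord0).
by split=> _ i; rewrite leNye.
Qed.

(** A finite scalar [l] is invertible, so [x = l y] splits into the two
    inequalities [l y <= x] and [- l x <= y]. *)
Lemma fin_multiple_bounds x y : fin_multiple x y <->
  exists l : R, vle (tscale (of_fin S l) y) x /\ vle (tscale (of_fin S (- l)) x) y.
Proof.
split=> [[l ->]|[l [yx xy]]].
  by exists l; split; rewrite ?tscaleD ?addNr ?tscale0; exact: vle_refl.
exists l; apply: vle_anti => // i; move: (xy i).
rewrite /tle !mxE !to_ext_totimes.
have finE m : to_ext (of_fin S m) = m%:E by case: S.
by rewrite !finE addeC EFinN leeBlDr // addeC.
Qed.

Lemma fin_multiple_ext x y : fin_multiple x y <->
  @fin_multiple R Tbar _ (map_mx (@to_ext R S) x) (map_mx (@to_ext R S) y).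
Proof.
have scaleE (l : R) i : to_ext (tscale (of_fin S l) y 0 i) =
    tscale (of_fin Tbar l) (map_mx (@to_ext R S) y : 'rV[carrier R Tbar]_n.+1) 0 i.
  by rewrite !mxE to_ext_totimes; case: S y.
split=> -[l] /rowP h; exists l; apply/rowP => i.
  by rewrite -scaleE -h mxE.
by apply: to_ext_inj; rewrite scaleE -h mxE.
Qed.

(** Both cases of the definition of the distance are covered: the brackets are
    suprema of the scalars in question, and being a finite multiple is expressed
    by two such scalars. *)
Lemma eq_dH_scalars x y x' y' :
    (forall l, vle (tscale l x) y <-> vle (tscale l x') y') ->
    (forall l, vle (tscale l y) x <-> vle (tscale l y') x') ->
  dH x y = dH x' y'.
Proof.
move=> xy yx; rewrite /dH /dH_ext.
have eqb u v u' v' :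
    (forall l, vle (tscale l u) v <-> vle (tscale l u') v') ->
    bracket (map_mx (@to_ext R S) u) (map_mx (@to_ext R S) v) =
    bracket (map_mx (@to_ext R S) u') (map_mx (@to_ext R S) v').
  have mapE (w z : 'rV[K]_n.+1) (l : \bar R) :
      (forall i, l + map_mx (@to_ext R S) w 0%R i <=
                 map_mx (@to_ext R S) z 0%R i)%E <->
      (forall i, l + to_ext (w 0%R i) <= to_ext (z 0%R i))%E.
    by split=> wz i; move: (wz i); rewrite !mxE.
  move=> /ext_scalars h; congr ereal_sup; apply/seteqP.
  by split=> l /= /mapE/h/mapE.
rewrite (eqb _ _ _ _ xy) (eqb _ _ _ _ yx).
congr (if _ then _ else _); apply: asbool_equiv_eq.
rewrite -!fin_multiple_ext !fin_multiple_bounds.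
by split=> -[l [h k]]; exists l; split; [apply/yx|apply/xy|apply/yx|apply/xy].
Qed.

(** * The embeddings *)

Lemma repr_colspace A x : colspace A x -> colspace A (repr (to_proj x)).
Proof.
have [l ->] : fin_multiple (repr (to_proj x)) x.
  apply/asboolP; rewrite -[asbool _]/(proj_equiv R S n.+1 _ _).
  by apply/eqmodP; rewrite /to_proj reprK.
by move=> /colspaceP[v ->]; apply/colspaceP; eexists; rewrite -tapp_scale.
Qed.

(** The map [x |-> B (r x)] is a section of [P] over [C(PB)]: if [x = PB v]
    then [v <= r x], so [x <= PB (r x) <= x].  Scaled inequalities then travel
    forward through [r] and [B], and backward through [P]. *)
Lemma tscale_le_section P B r l x y :
    (forall z v, vle (tapp (tmulmx P B) v) z <-> vle v (r z)) ->
    colspace (tmulmx P B) x -> colspace (tmulmx P B) y ->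
  vle (tscale l x) y <-> vle (tscale l (tapp B (r x))) (tapp B (r y)).
Proof.
move=> rP.
have section z : colspace (tmulmx P B) z -> tapp P (tapp B (r z)) = z.
  move=> /colspaceP[v ->]; rewrite -tapp_mul; apply: vle_anti.
    by apply/rP; exact: vle_refl.
  by apply: tapp_monotone; apply/rP; exact: vle_refl.
move=> /section xE /section yE; split=> [lxy|/(@tapp_monotone P)].
  rewrite -tapp_scale; apply: tapp_monotone; apply/rP.
  by rewrite tapp_scale tapp_mul xE.
by rewrite tapp_scale xE yE.
Qed.

(** The section is evaluated at the chosen representative of each class;
    this stays in [C(PB)], which is closed under scaling. *)
Lemma embeds_PC_mull P B : embeds_isometrically (PC (tmulmx P B)) (PC B).
Proof.
have [r rP] := tapp_residual (tmulmx P B).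
exists (fun p => to_proj (tapp B (r (repr p)))); split=> [p _|p q].
  by exists (tapp B (r (repr p))) => //; apply/colspaceP; eexists.
move=> [x /repr_colspace + xp] [y /repr_colspace + yq]; rewrite xp yq => px qy.
rewrite dHP_to_proj; apply: eq_dH_scalars => l; apply: iff_sym;
exact: tscale_le_section rP _ _.
Qed.

Lemma embeds_PC_mulr B Q : embeds_isometrically (PC (tmulmx B Q)) (PC B).
Proof.
exists id; split=> // _ [x /colspaceP[v ->] <-].
exists (tapp (tmulmx B Q) v) => //.
by apply/colspaceP; exists (tapp Q v); rewrite tapp_mul.
Qed.

Lemma embeds_trans (X Y Z : set (Defs.proj R S n.+1)) :
  embeds_isometrically X Y -> embeds_isometrically Y Z ->
  embeds_isometrically X Z.
Proof.
move=> [f [fXY fd]] [g [gYZ gd]]; exists (g \o f); split=> [p /fXY/gYZ //|].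
by move=> p q Xp Xq /=; rewrite gd ?fd //; exact: fXY.
Qed.

(** The factors live in [option] because matrices over the finitary semiring
    need not form a monoid. *)
Lemma embeds_PC_factor A B (P Q : option 'M[K]_n.+1) :
  Some A = mul1 (@tmulmx R S n) (mul1 (@tmulmx R S n) P (Some B)) Q ->
  embeds_isometrically (PC A) (PC B).
Proof.
case: P Q => [P|] [Q|] /= [->].
- exact: embeds_trans (embeds_PC_mulr _ _) (embeds_PC_mull _ _).
- exact: embeds_PC_mull.
- exact: embeds_PC_mulr.
- by exists id.
Qed.

Lemma PC_tr A : PC A^T = PR A.
Proof.
rewrite /PC /PR /colspace /rowspace; congr image.
have -> : (fun j => (col j A^T)^T) = (fun j => row j A).
  by apply/funext => j; rewrite tr_col trmxK.
by [].
Qed.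

Lemma tmulmx_tr A B : (tmulmx A B)^T = tmulmx B^T A^T.
Proof.
apply/matrixP => i j; rewrite !mxE; congr tsum.
by apply/funext => k; rewrite !mxE totimesC.
Qed.

Lemma row_tmulmx A B i : row i (tmulmx A B) = tapp B^T (row i A).
Proof.
apply/rowP => j; rewrite tappE !mxE; congr tsum.
by apply/funext => k; rewrite !mxE.
Qed.

(** Row by row, this is the compatibility of the action with products of the
    transposed matrices. *)
Lemma tmulmxA A B M : tmulmx A (tmulmx B M) = tmulmx (tmulmx A B) M.
Proof.
by apply/row_matrixP => i; rewrite !row_tmulmx tmulmx_tr tapp_mul.
Qed.

Lemma leJ_factor A B : leJ (@tmulmx R S n) A B ->
  exists P Q : option 'M[K]_n.+1,
    Some A = mul1 (@tmulmx R S n) (mul1 (@tmulmx R S n) P (Some B)) Q.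
Proof.
move=> AB; suff /AB[P _ [Q _ <-]] : ideal1 (@tmulmx R S n) A (Some A).
  by exists P, Q.
have [[e eP]|noe] := pselect (is_monoid (@tmulmx R S n)).
  exists (Some e) => //; exists (Some e) => //=.
  by have [-> _] := eP A; have [_ ->] := eP A.
by exists None => //; exists None.
Qed.

End Vectors.
End Embedding.

Theorem theorem5p4 (R : realType) (S : tropical) (n : nat)
    (A B : 'M[carrier R S]_n.+1)
    (hAB : leJ (@tmulmx R S n) A B) :
  embeds_isometrically (PC A) (PC B) /\ embeds_isometrically (PR A) (PR B).
Proof.
have [P [Q AE]] := leJ_factor hAB; split; first exact: embeds_PC_factor AE.
(* transposition exchanges the left and right factors *)
rewrite -!PC_tr; apply: (@embeds_PC_factor _ _ _ _ _ (omap trmx Q) (omap trmx P)).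
by case: P Q AE => [P|] [Q|] /= [->]; rewrite ?tmulmx_tr ?tmulmxA.
Qed.
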